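(* Let $c>0$, $g\in C^2([0,\infty))$, $h\in C^1([0,\infty))$, $\nu\in C^2([0,\infty))$, and let $u: D^+\cup D^-\to\mathbb{R}$ be the solution (given by the explicit formula in the context) of the Dirichlet problem $$u_{tt}-c^2u_{xx}=0\ (x>0,t>0),\quad u(x,0)=g(x),\ u_t(x,0)=h(x)\ (x>0),\quad u(0,t)=\nu(t)\ (t>0).$$ Then at every point $(x,x/c)$, $x>0$, of the characteristic line the first partial derivatives of $u$ have the jumps $$[u_x]_{t=x/c}=\tfrac1c\,h(0)-\tfrac1c\,\nu'(0),\qquad [u_t]_{t=x/c}=-h(0)+\nu'(0).$$ In particular, $u_x$ and $u_t$ are discontinuous across $t=x/c$ whenever these jumps are nonzero.
   Context: Domains: $D^+=\{(x,t): x>0,\ t>0,\ x>ct\}$ and $D^-=\{(x,t): t>0,\ 0<x<ct\}$, separated by the characteristic line $x=ct$. The solution of the Dirichlet problem means the function obtained from d'Alembert's formula: $$u(x,t)=\tfrac12[g(x+ct)+g(x-ct)]+\tfrac1{2c}\int_{x-ct}^{x+ct}h(\xi)\,d\xi,\quad (x,t)\in D^+,$$ $$u(x,t)=\tfrac12[g(x+ct)-g(ct-x)]+\tfrac1{2c}\Big[\int_0^{x+ct}h(\xi)\,d\xi-\int_0^{ct-x}h(\xi)\,d\xi\Big]+\nu(t-x/c),\quad (x,t)\in D^-.$$ For a function $w$ on $D^+\cup D^-$, the jump at a point $(x_0,x_0/c)$, $x_0>0$, is $[w]_{t=x/c}=\lim_{D^-\ni(x,t)\to(x_0,x_0/c)}w(x,t)-\lim_{D^+\ni(x,t)\to(x_0,x_0/c)}w(x,t)$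 (both limits existing). $w$ is continuous across the line if this jump is zero at every such point. The derivatives $u_x,u_t$ are taken in the open sets $D^+$ and $D^-$. *)

(* Defs.v *)
From Stdlib Require Import Reals.
From Coquelicot Require Import Coquelicot.
Open Scope R_scope.

(** Functions on [0,oo) are represented by total functions on [R]; every notion
    below only looks at their values on [0,oo). *)
Definition half_line (x : R) : Prop := 0 <= x.

(** [is_derive f x l] is [filterdiff f (locally x) (fun y => scal y l)]; here the
    neighbourhoods are restricted to [0,oo), so that the derivative is two-sided
    at [x > 0] and right-sided at [x = 0]. *)
Definition is_derive_half (f : R -> R) (x l : R) : Prop :=
  filterdiff f (within half_line (locally x)) (fun y => scal y l).

Fixpoint C_half (k : nat) (f : R -> R) : Prop :=
  match k with
  | O => continuous_on half_line f
  | S k' => exists f' : R -> R,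
      (forall x, half_line x -> is_derive_half f x (f' x)) /\ C_half k' f'
  end.

Definition dom_plus (c : R) (p : R * R) : Prop :=
  0 < fst p /\ 0 < snd p /\ c * snd p < fst p.

Definition dom_minus (c : R) (p : R * R) : Prop :=
  0 < snd p /\ 0 < fst p < c * snd p.

(** The solution of the Dirichlet problem given by d'Alembert's formula. The
    values of [u] outside [dom_plus c] and [dom_minus c] are left unspecified. *)
Definition dirichlet_solution (c : R) (g h nu : R -> R) (u : R -> R -> R) : Prop :=
  (forall x t, dom_plus c (x, t) ->
     u x t = / 2 * (g (x + c * t) + g (x - c * t))
             + / (2 * c) * RInt h (x - c * t) (x + c * t)) /\
  (forall x t, dom_minus c (x, t) ->
     u x t = / 2 * (g (x + c * t) - g (c * t - x))
             + / (2 * c) * (RInt h 0 (x + c * t) - RInt h 0 (c * t - x))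
             + nu (t - x / c)).

Definition partial_x (u : R -> R -> R) (x t : R) : R := Derive (fun y => u y t) x.
Definition partial_t (u : R -> R -> R) (x t : R) : R := Derive (fun s => u x s) t.

(** [Derive] is total, so existence of the partial derivatives is separate. *)
Definition has_partials (u : R -> R -> R) (x t : R) : Prop :=
  ex_derive (fun y => u y t) x /\ ex_derive (fun s => u x s) t.

(** Both one-sided limits of [w] at [(x0, x0/c)] exist and are finite, and [J] is
    the limit from [dom_minus c] minus the limit from [dom_plus c]. *)
Definition is_jump (c : R) (w : R -> R -> R) (x0 J : R) : Prop :=
  exists lm lp : R,
    filterlim (fun p : R * R => w (fst p) (snd p))
      (within (dom_minus c) (locally (x0, x0 / c))) (locally lm) /\
    filterlim (fun p : R * R => w (fst p) (snd p))
      (within (dom_plus c) (locally (x0, x0 / c))) (locally lp) /\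
    J = lm - lp.

Definition continuous_across (c : R) (w : R -> R -> R) : Prop :=
  forall x0, 0 < x0 -> is_jump c w x0 0.

(* Main.v *)
Require Import Defs.
From Stdlib Require Import Reals Lra.
From Coquelicot Require Import Coquelicot.
Open Scope R_scope.

(** Both branches of d'Alembert's formula are travelling waves
    [F (x + c * t) + G (x - c * t)] with the same [F], namely
    [F s = g s / 2 + (int_0^s h) / (2 * c)].  Only [G] differs: with
    [H s = int_0^s h],
    - ahead of the characteristic, where [s = x - c * t > 0],
      [G s = g s / 2 - H s / (2 * c)];
    - behind it, where [s < 0],
      [G s = - g (- s) / 2 - H (- s) / (2 * c) + nu (- s / c)].
    Hence [u_x = F' + G'] and [u_t = c * (F' - G')] on each side
    ([is_derive_wave]).  Along [x = c * t] the argument of [F'] is positive, so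
    [F'] contributes the same limit from both sides and cancels in the jump,
    while [G'] is evaluated at [s -> 0].  Therefore [[u_x] = J] and
    [[u_t] = - c * J], where
    [J = G'(0-) - G'(0+) = h 0 / c - nu' 0 / c]: the terms in [g' 0] agree, those
    in [h 0] have opposite signs, and [nu] occurs on one side only.

    The limits are obtained by extending [g'], [h] and [nu'] from [[0,oo)] to
    continuous functions on the line ([clamp]); the formulas for [F'] and [G']
    then make sense and are continuous everywhere ([filterlim_wave_partials]).
    A nonzero jump contradicts continuity because jumps are unique, the
    characteristic line being in the closure of both domains. *)

(** * One-sided calculus on the half-line *)

(** The extension of [f] from the half-line that is constant on the negative
    side: it turns continuity on [[0,oo)] into continuity on the line. *)
Definition clamp (f : R -> R) (x : R) : R := f (Rmax 0 x).

Lemma clamp_id (f : R -> R) (x : R) : 0 <= x -> clamp f x = f x.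
Proof. intros Hx; unfold clamp; now rewrite Rmax_right. Qed.

Lemma continuous_clamp (f : R -> R) (x : R) :
  continuous_on half_line f -> continuous (clamp f) x.
Proof.
  intros Hf.
  apply (filterlim_comp _ _ _ (Rmax 0) f _
           (within half_line (locally (Rmax 0 x)))).
  - intros P [d Hd]; exists d; intros y Hy.
    apply Hd; [| apply Rmax_l].
    (* the retraction onto the half-line does not increase distances *)
    change (Rabs (y - x) < d) in Hy.
    change (Rabs (Rmax 0 y - Rmax 0 x) < d).
    revert Hy; unfold Rmax, Rabs.
    destruct (Rle_dec 0 y), (Rle_dec 0 x); repeat destruct Rcase_abs; lra.
  - apply Hf, Rmax_l.
Qed.

Lemma is_derive_half_is_derive (f : R -> R) (x l : R) :
  0 < x -> is_derive_half f x l -> is_derive f x l.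
Proof.
  intros Hx [Hl Hd]; split; [exact Hl |].
  intros y Hy eps.
  assert (Hw : is_filter_lim (within half_line (locally x)) y).
  { intros P HP; apply filter_le_within, Hy, HP. }
  generalize (Hd y Hw eps) (open_gt 0 x Hx).
  unfold within; intros H1 H2; generalize (filter_and _ _ H1 H2).
  apply filter_imp; intros z [Hz Hz0]; apply Hz; unfold half_line; lra.
Qed.

Lemma is_filter_lim_within_half (x : R) :
  is_filter_lim (within half_line (locally x)) x.
Proof. intros P HP; now apply filter_le_within. Qed.

(** If [k] and [l] are both derivatives of [f] at [0], then
    [|k - l| y <= eps y] for small [y > 0], for every [eps]. *)
Lemma is_derive_half_unique0 (f : R -> R) (k l : R) :
  is_derive_half f 0 k -> is_derive_half f 0 l -> k = l.
Proof.
  intros [_ Hk] [_ Hl].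
  specialize (Hk 0 (is_filter_lim_within_half 0)).
  specialize (Hl 0 (is_filter_lim_within_half 0)).
  destruct (Req_dec k l) as [| Hne]; [assumption | exfalso].
  assert (He : 0 < Rabs (k - l) / 4).
  { assert (0 < Rabs (k - l)) by (apply Rabs_pos_lt; lra); lra. }
  destruct (filter_and _ _ (Hk (mkposreal _ He)) (Hl (mkposreal _ He)))
    as [d Hd].
  assert (Hd0 := cond_pos d).
  assert (Hball : ball 0 d (d / 2)).
  { change (Rabs (d / 2 - 0) < d); rewrite Rabs_right; lra. }
  assert (Hh : half_line (d / 2)) by (unfold half_line; lra).
  destruct (Hd _ Hball Hh) as [Bk Bl].
  change (Rabs (f (d / 2) - f 0 - (d / 2 - 0) * k)
          <= Rabs (k - l) / 4 * Rabs (d / 2 - 0)) in Bk.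
  change (Rabs (f (d / 2) - f 0 - (d / 2 - 0) * l)
          <= Rabs (k - l) / 4 * Rabs (d / 2 - 0)) in Bl.
  rewrite Rminus_0_r in Bk, Bl.
  rewrite (Rabs_right (d / 2)) in Bk, Bl by lra.
  assert (Heq : Rabs ((k - l) * (d / 2)) = Rabs (k - l) * (d / 2)).
  { rewrite Rabs_mult, (Rabs_right (d / 2)); lra. }
  assert (Htri := Rabs_triang
            (- (f (d / 2) - f 0 - d / 2 * k)) (f (d / 2) - f 0 - d / 2 * l)).
  rewrite Rabs_Ropp in Htri.
  replace (- (f (d / 2) - f 0 - d / 2 * k) + (f (d / 2) - f 0 - d / 2 * l))
    with ((k - l) * (d / 2)) in Htri by ring.
  assert (0 < Rabs (k - l) * d) by (apply Rmult_lt_0_compat; lra).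
  lra.
Qed.

Lemma C_half_1_continuous (f : R -> R) : C_half 1 f -> continuous_on half_line f.
Proof.
  intros [f' [Hf' _]] x Hx.
  apply (@filterdiff_continuous_aux R_AbsRing R_NormedModule R_NormedModule);
    [apply within_filter, locally_filter | | apply is_filter_lim_within_half].
  eexists; exact (Hf' x Hx).
Qed.

Lemma C_half_2_C1 (f : R -> R) :
  C_half 2 f -> exists f' : R -> R,
    (forall x, half_line x -> is_derive_half f x (f' x)) /\
    continuous_on half_line f'.
Proof.
  intros [f' [Hf' H1]]; exists f'; split; [exact Hf' |].
  now apply C_half_1_continuous.
Qed.

Lemma ex_RInt_half (h : R -> R) (a b : R) :
  continuous_on half_line h -> 0 <= a -> 0 <= b -> ex_RInt h a b.
Proof.
  intros Hh Ha Hb.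
  apply (ex_RInt_ext (clamp h)).
  - intros x [Hx _]; apply clamp_id.
    assert (0 <= Rmin a b) by (apply Rmin_glb; assumption); lra.
  - apply @ex_RInt_continuous; intros z _; now apply continuous_clamp.
Qed.

Lemma is_derive_RInt_half (h : R -> R) (x : R) :
  continuous_on half_line h -> 0 < x -> is_derive (RInt h 0) x (h x).
Proof.
  intros Hh Hx.
  assert (Hpos : locally x (fun y => 0 < y)) by exact (open_gt 0 x Hx).
  apply (is_derive_RInt h (RInt h 0) 0 x).
  - generalize Hpos; apply filter_imp; intros y Hy.
    apply (@RInt_correct R_CompleteNormedModule), ex_RInt_half; lra || exact Hh.
  - apply (continuous_ext_loc h (clamp h) x).
    + generalize Hpos; apply filter_imp; intros y Hy.
      apply clamp_id; lra.
    + now apply continuous_clamp.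
Qed.

(** * The two domains *)

Lemma open_dom_plus (c : R) : open (dom_plus c).
Proof.
  assert (Hf : forall p : R * R, continuous (fun q : R * R => fst q) p)
    by (intros [a b]; apply @continuous_fst).
  assert (Hs : forall p : R * R, continuous (fun q : R * R => snd q) p)
    by (intros [a b]; apply @continuous_snd).
  apply open_and; [| apply open_and].
  - apply (open_comp (fun q : R * R => fst q) (fun y => 0 < y));
      [intros p _; apply Hf | apply open_gt].
  - apply (open_comp (fun q : R * R => snd q) (fun y => 0 < y));
      [intros p _; apply Hs | apply open_gt].
  - apply (open_ext (fun q : R * R => 0 < fst q - c * snd q));
      [intros p; split; lra |].
    apply (open_comp (fun q : R * R => fst q - c * snd q) (fun y => 0 < y));
      [intros p _ | apply open_gt].
    apply (continuous_minus (fun q : R * R => fst q) (fun q => c * snd q)); [apply Hf |].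
    apply (continuous_scal_r c (fun q : R * R => snd q)), Hs.
Qed.

Lemma open_dom_minus (c : R) : open (dom_minus c).
Proof.
  assert (Hf : forall p : R * R, continuous (fun q : R * R => fst q) p)
    by (intros [a b]; apply @continuous_fst).
  assert (Hs : forall p : R * R, continuous (fun q : R * R => snd q) p)
    by (intros [a b]; apply @continuous_snd).
  apply open_and; [| apply open_and].
  - apply (open_comp (fun q : R * R => snd q) (fun y => 0 < y));
      [intros p _; apply Hs | apply open_gt].
  - apply (open_comp (fun q : R * R => fst q) (fun y => 0 < y));
      [intros p _; apply Hf | apply open_gt].
  - apply (open_ext (fun q : R * R => 0 < c * snd q - fst q));
      [intros p; split; lra |].
    apply (open_comp (fun q : R * R => c * snd q - fst q) (fun y => 0 < y));
      [intros p _ | apply open_gt].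
    apply (continuous_minus (fun q : R * R => c * snd q) (fun q => fst q)); [| apply Hf].
    apply (continuous_scal_r c (fun q : R * R => snd q)), Hs.
Qed.

(** Limits within [D] are unique at points of the closure of [D]; the points
    needed here are approached along the vertical line through them. *)
Lemma within_proper_of_vertical (D : R * R -> Prop) (x0 t0 : R) :
  (forall eps, 0 < eps -> exists t, Rabs (t - t0) < eps /\ D (x0, t)) ->
  ProperFilter' (within D (locally (x0, t0))).
Proof.
  intros H; constructor; [| apply within_filter; apply locally_filter].
  intros [d Hd].
  destruct (H d (cond_pos d)) as [t [Ht HD]].
  apply (Hd (x0, t)); [split; [apply ball_center | exact Ht] | exact HD].
Qed.

Lemma within_dom_plus_proper (c x0 : R) :
  0 < c -> 0 < x0 -> ProperFilter' (within (dom_plus c) (locally (x0, x0 / c))).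
Proof.
  intros Hc Hx; apply within_proper_of_vertical; intros eps He.
  assert (Ht : 0 < x0 / c) by (apply Rdiv_lt_0_compat; assumption).
  assert (Hm := Rmin_l eps (x0 / c)); assert (Hm' := Rmin_r eps (x0 / c)).
  assert (0 < Rmin eps (x0 / c)) by (apply Rmin_glb_lt; assumption).
  exists (x0 / c - Rmin eps (x0 / c) / 2); split.
  - rewrite Rabs_left; lra.
  - assert (0 < c * (Rmin eps (x0 / c) / 2)) by (apply Rmult_lt_0_compat; lra).
    assert (c * (x0 / c) = x0) by (field; lra).
    unfold dom_plus; simpl; repeat split; lra.
Qed.

Lemma within_dom_minus_proper (c x0 : R) :
  0 < c -> 0 < x0 -> ProperFilter' (within (dom_minus c) (locally (x0, x0 / c))).
Proof.
  intros Hc Hx; apply within_proper_of_vertical; intros eps He.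
  assert (Ht : 0 < x0 / c) by (apply Rdiv_lt_0_compat; assumption).
  exists (x0 / c + eps / 2); split.
  - rewrite Rabs_right; lra.
  - assert (0 < c * (eps / 2)) by (apply Rmult_lt_0_compat; lra).
    assert (c * (x0 / c) = x0) by (field; lra).
    unfold dom_minus; simpl; repeat split; lra.
Qed.

Lemma is_jump_unique (c : R) (w : R -> R -> R) (x0 J K : R) :
  0 < c -> 0 < x0 -> is_jump c w x0 J -> is_jump c w x0 K -> J = K.
Proof.
  intros Hc Hx [lm [lp [Hm [Hp ->]]]] [km [kp [Hm' [Hp' ->]]]].
  assert (Hpf := within_dom_plus_proper c x0 Hc Hx).
  assert (Hmf := within_dom_minus_proper c x0 Hc Hx).
  rewrite (filterlim_locally_unique _ _ _ Hm Hm').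
  now rewrite (filterlim_locally_unique _ _ _ Hp Hp').
Qed.

Lemma nonzero_jump_discontinuous (c : R) (w : R -> R -> R) (J : R) :
  0 < c -> (forall x, 0 < x -> is_jump c w x J) -> J <> 0 ->
  ~ continuous_across c w.
Proof.
  intros Hc HJ Hne Hcont; apply Hne.
  apply (is_jump_unique c w 1); auto with real.
Qed.

(** * Travelling waves *)

(** The profiles need only be differentiable at the points that [D] reaches,
    whereas [F'] and [G'] are parameters so that they can be chosen continuous
    beyond these points, in particular up to the boundary of [D]. *)
Definition wave_on (c : R) (D : R * R -> Prop) (u : R -> R -> R)
    (F' G' : R -> R) : Prop :=
  exists F G : R -> R, forall x t, D (x, t) ->
    u x t = F (x + c * t) + G (x - c * t) /\
    is_derive F (x + c * t) (F' (x + c * t)) /\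
    is_derive G (x - c * t) (G' (x - c * t)).

Lemma is_derive_wave (c : R) (D : R * R -> Prop) (u : R -> R -> R)
    (F' G' : R -> R) (x t : R) :
  open D -> wave_on c D u F' G' -> D (x, t) ->
  is_derive (fun y => u y t) x (F' (x + c * t) + G' (x - c * t)) /\
  is_derive (fun s => u x s) t (c * (F' (x + c * t) - G' (x - c * t))).
Proof.
  intros HD [F [G Hu]] Hxt.
  destruct (Hu x t Hxt) as [_ [HF HG]].
  destruct (HD _ Hxt) as [d Hd].
  split.
  - apply (is_derive_ext_loc (fun y => F (y + c * t) + G (y - c * t))).
    + exists d; intros y Hy; symmetry; apply Hu, Hd.
      split; [exact Hy | apply ball_center].
    + apply (is_derive_plus (fun y => F (y + c * t)) (fun y => G (y - c * t))).
      * rewrite <- (Rmult_1_l (F' _)).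
        apply (is_derive_comp F (fun y => y + c * t)); [exact HF |].
        auto_derive; [exact I | ring].
      * rewrite <- (Rmult_1_l (G' _)).
        apply (is_derive_comp G (fun y => y - c * t)); [exact HG |].
        auto_derive; [exact I | ring].
  - apply (is_derive_ext_loc (fun s => F (x + c * s) + G (x - c * s))).
    + exists d; intros s Hs; symmetry; apply Hu, Hd.
      split; [apply ball_center | exact Hs].
    + replace (c * (F' (x + c * t) - G' (x - c * t)))
        with (plus (c * F' (x + c * t)) (- c * G' (x - c * t)))
        by (unfold plus; simpl; ring).
      apply (is_derive_plus (fun s => F (x + c * s)) (fun s => G (x - c * s))).
      * apply (is_derive_comp F (fun s => x + c * s)); [exact HF |].
        auto_derive; [exact I | ring].
      * apply (is_derive_comp G (fun s => x - c * s)); [exact HG |].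
        auto_derive; [exact I | ring].
Qed.

(** The formulas of [is_derive_wave] are continuous functions of [(x, t)] in the
    whole plane, so the limits within [D] are their values. *)
Lemma filterlim_wave_partials (c : R) (D : R * R -> Prop) (u : R -> R -> R)
    (F' G' : R -> R) (x0 t0 : R) :
  open D -> wave_on c D u F' G' ->
  (forall s, continuous F' s) -> (forall s, continuous G' s) ->
  filterlim (fun p : R * R => partial_x u (fst p) (snd p))
    (within D (locally (x0, t0)))
    (locally (F' (x0 + c * t0) + G' (x0 - c * t0))) /\
  filterlim (fun p : R * R => partial_t u (fst p) (snd p))
    (within D (locally (x0, t0)))
    (locally (c * (F' (x0 + c * t0) - G' (x0 - c * t0)))).
Proof.
  intros HD Hw HF HG.
  assert (Hct : continuous (fun p : R * R => c * snd p) (x0, t0)).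
  { apply (continuous_scal_r c (fun p : R * R => snd p)), @continuous_snd. }
  assert (HFp : continuous (fun p : R * R => F' (fst p + c * snd p)) (x0, t0)).
  { apply (continuous_comp (fun p : R * R => fst p + c * snd p) F'); [| apply HF].
    apply (continuous_plus (fun p : R * R => fst p) (fun p => c * snd p));
      [apply @continuous_fst | exact Hct]. }
  assert (HGp : continuous (fun p : R * R => G' (fst p - c * snd p)) (x0, t0)).
  { apply (continuous_comp (fun p : R * R => fst p - c * snd p) G'); [| apply HG].
    apply (continuous_minus (fun p : R * R => fst p) (fun p => c * snd p));
      [apply @continuous_fst | exact Hct]. }
  split.
  - apply (filterlim_within_ext _
             (fun p : R * R => F' (fst p + c * snd p) + G' (fst p - c * snd p))).
    + intros [x t] Hxt; symmetry; apply is_derive_unique.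
      now apply (is_derive_wave c D u F' G').
    + apply (filterlim_filter_le_1 _ (filter_le_within D)).
      exact (continuous_plus _ _ _ HFp HGp).
  - apply (filterlim_within_ext _
             (fun p : R * R =>
                c * (F' (fst p + c * snd p) - G' (fst p - c * snd p)))).
    + intros [x t] Hxt; symmetry; apply is_derive_unique.
      now apply (is_derive_wave c D u F' G').
    + apply (filterlim_filter_le_1 _ (filter_le_within D)).
      exact (continuous_scal_r c _ _ (continuous_minus _ _ _ HFp HGp)).
Qed.

(** [F'] is continuous across the characteristic and cancels: a common forward
    profile [F'] leaves only the jump of [G'] at [0]. *)
Lemma wave_jumps (c : R) (u : R -> R -> R) (F' Gm' Gp' : R -> R) (x0 : R) :
  0 < c ->
  wave_on c (dom_minus c) u F' Gm' -> wave_on c (dom_plus c) u F' Gp' ->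
  (forall s, continuous F' s) -> (forall s, continuous Gm' s) ->
  (forall s, continuous Gp' s) ->
  is_jump c (partial_x u) x0 (Gm' 0 - Gp' 0) /\
  is_jump c (partial_t u) x0 (- c * (Gm' 0 - Gp' 0)).
Proof.
  intros Hc Hm Hp HF HGm HGp.
  assert (H0 : x0 - c * (x0 / c) = 0) by (field; lra).
  destruct (filterlim_wave_partials c _ u F' Gm' x0 (x0 / c)
              (open_dom_minus c) Hm HF HGm) as [Mx Mt].
  destruct (filterlim_wave_partials c _ u F' Gp' x0 (x0 / c)
              (open_dom_plus c) Hp HF HGp) as [Px Pt].
  rewrite H0 in Mx, Mt, Px, Pt.
  split; eexists; eexists; (split; [eassumption | split; [eassumption | ring]]).
Qed.

(** * The d'Alembert profiles *)

(** Derivatives of the profiles in d'Alembert's formula: [F'], and [G'] ahead of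
    the characteristic ([backward_plus']) and behind it ([backward_minus']). *)
Definition forward' (c : R) (g' h : R -> R) (s : R) : R :=
  / 2 * clamp g' s + / (2 * c) * clamp h s.
Definition backward_plus' (c : R) (g' h : R -> R) (s : R) : R :=
  / 2 * clamp g' s - / (2 * c) * clamp h s.
Definition backward_minus' (c : R) (g' h nu' : R -> R) (s : R) : R :=
  / 2 * clamp g' (- s) + / (2 * c) * clamp h (- s) - / c * clamp nu' (- s / c).

Lemma continuous_forward' (c : R) (g' h : R -> R) (s : R) :
  continuous_on half_line g' -> continuous_on half_line h ->
  continuous (forward' c g' h) s.
Proof.
  intros Hg Hh.
  apply (continuous_plus (fun s => / 2 * clamp g' s) (fun s => / (2 * c) * clamp h s));
    [apply (continuous_scal_r _ (clamp g')) | apply (continuous_scal_r _ (clamp h))];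
    now apply continuous_clamp.
Qed.

Lemma continuous_backward_plus' (c : R) (g' h : R -> R) (s : R) :
  continuous_on half_line g' -> continuous_on half_line h ->
  continuous (backward_plus' c g' h) s.
Proof.
  intros Hg Hh.
  apply (continuous_minus (fun s => / 2 * clamp g' s) (fun s => / (2 * c) * clamp h s));
    [apply (continuous_scal_r _ (clamp g')) | apply (continuous_scal_r _ (clamp h))];
    now apply continuous_clamp.
Qed.

Lemma continuous_backward_minus' (c : R) (g' h nu' : R -> R) (s : R) :
  continuous_on half_line g' -> continuous_on half_line h ->
  continuous_on half_line nu' ->
  continuous (backward_minus' c g' h nu') s.
Proof.
  intros Hg Hh Hnu.
  assert (Ho : continuous (fun s : R => - s) s)
    by exact (continuous_opp (fun s : R => s) s (continuous_id s)).
  apply (continuous_minus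
           (fun s => / 2 * clamp g' (- s) + / (2 * c) * clamp h (- s))
           (fun s => / c * clamp nu' (- s / c))).
  - apply (continuous_plus (fun s => / 2 * clamp g' (- s))
             (fun s => / (2 * c) * clamp h (- s))).
    + apply (continuous_scal_r _ (fun s => clamp g' (- s))).
      apply (continuous_comp Ropp (clamp g')); [exact Ho |].
      now apply continuous_clamp.
    + apply (continuous_scal_r _ (fun s => clamp h (- s))).
      apply (continuous_comp Ropp (clamp h)); [exact Ho |].
      now apply continuous_clamp.
  - apply (continuous_scal_r _ (fun s => clamp nu' (- s / c))).
    apply (continuous_comp (fun s => - s / c) (clamp nu'));
      [| now apply continuous_clamp].
    exact (continuous_scal_l (fun s : R => - s) (/ c) s Ho).
Qed.

Lemma is_derive_forward (c : R) (g g' h : R -> R) (s : R) :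
  (forall x, half_line x -> is_derive_half g x (g' x)) ->
  continuous_on half_line h -> 0 < s ->
  is_derive (fun s => / 2 * g s + / (2 * c) * RInt h 0 s) s (forward' c g' h s).
Proof.
  intros Hg Hh Hs; unfold forward'; rewrite !clamp_id by lra.
  apply (is_derive_plus (fun s => / 2 * g s) (fun s => / (2 * c) * RInt h 0 s)).
  - apply (is_derive_scal g), is_derive_half_is_derive; [exact Hs |].
    apply Hg; unfold half_line; lra.
  - apply (is_derive_scal (RInt h 0)); now apply is_derive_RInt_half.
Qed.

(** The backward profile ahead of the characteristic is the forward profile of
    the wave speed [- c]. *)
Lemma is_derive_backward_plus (c : R) (g g' h : R -> R) (s : R) :
  c <> 0 ->
  (forall x, half_line x -> is_derive_half g x (g' x)) ->
  continuous_on half_line h -> 0 < s ->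
  is_derive (fun s => / 2 * g s - / (2 * c) * RInt h 0 s) s
    (backward_plus' c g' h s).
Proof.
  intros Hc Hg Hh Hs.
  replace (backward_plus' c g' h s) with (forward' (- c) g' h s)
    by (unfold backward_plus', forward'; field; lra).
  apply (is_derive_ext (fun s => / 2 * g s + / (2 * - c) * RInt h 0 s)).
  - intros y; apply Rminus_diag_uniq; field; lra.
  - now apply is_derive_forward.
Qed.

Lemma is_derive_backward_minus (c : R) (g g' h nu nu' : R -> R) (s : R) :
  0 < c ->
  (forall x, half_line x -> is_derive_half g x (g' x)) ->
  continuous_on half_line h ->
  (forall x, half_line x -> is_derive_half nu x (nu' x)) -> s < 0 ->
  is_derive
    (fun s => - (/ 2 * g (- s) + / (2 * c) * RInt h 0 (- s)) + nu (- s / c)) s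
    (backward_minus' c g' h nu' s).
Proof.
  intros Hc Hg Hh Hnu Hs.
  assert (Hsc : 0 < - s / c) by (apply Rdiv_lt_0_compat; lra).
  assert (DF := is_derive_forward c g g' h (- s) Hg Hh ltac:(lra)).
  assert (Dn : is_derive nu (- s / c) (nu' (- s / c))).
  { apply is_derive_half_is_derive; [exact Hsc |].
    apply Hnu; unfold half_line; lra. }
  replace (backward_minus' c g' h nu' s)
    with (plus (opp (- 1 * forward' c g' h (- s))) (- / c * nu' (- s / c))).
  2:{ unfold backward_minus', forward', plus, opp; simpl.
      rewrite (clamp_id nu') by lra; field; lra. }
  apply (is_derive_plus
           (fun s => - (/ 2 * g (- s) + / (2 * c) * RInt h 0 (- s)))
           (fun s => nu (- s / c))).
  - apply (is_derive_opp (fun s => / 2 * g (- s) + / (2 * c) * RInt h 0 (- s))).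
    apply (is_derive_comp (fun s => / 2 * g s + / (2 * c) * RInt h 0 s) Ropp);
      [exact DF |].
    auto_derive; [exact I | ring].
  - apply (is_derive_comp nu (fun s => - s / c)); [exact Dn |].
    auto_derive; [exact I | field; lra].
Qed.

Lemma dirichlet_wave_plus (c : R) (g g' h nu : R -> R) (u : R -> R -> R) :
  0 < c ->
  (forall x, half_line x -> is_derive_half g x (g' x)) ->
  continuous_on half_line h -> dirichlet_solution c g h nu u ->
  wave_on c (dom_plus c) u (forward' c g' h) (backward_plus' c g' h).
Proof.
  intros Hc Hg Hh [Hu _].
  exists (fun s => / 2 * g s + / (2 * c) * RInt h 0 s),
         (fun s => / 2 * g s - / (2 * c) * RInt h 0 s).
  intros x t Hxt; rewrite (Hu x t Hxt).
  destruct Hxt as [Hx [Ht Hct]]; simpl in Hx, Ht, Hct.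
  assert (0 < c * t) by (apply Rmult_lt_0_compat; assumption).
  split; [| split].
  - assert (HI : RInt h 0 (x - c * t) + RInt h (x - c * t) (x + c * t)
                 = RInt h 0 (x + c * t)).
    { apply (RInt_Chasles h); apply ex_RInt_half; lra || exact Hh. }
    rewrite <- HI; ring.
  - apply is_derive_forward; lra || assumption.
  - apply is_derive_backward_plus; lra || assumption.
Qed.

Lemma dirichlet_wave_minus (c : R) (g g' h nu nu' : R -> R) (u : R -> R -> R) :
  0 < c ->
  (forall x, half_line x -> is_derive_half g x (g' x)) ->
  continuous_on half_line h ->
  (forall x, half_line x -> is_derive_half nu x (nu' x)) ->
  dirichlet_solution c g h nu u ->
  wave_on c (dom_minus c) u (forward' c g' h) (backward_minus' c g' h nu').
Proof.
  intros Hc Hg Hh Hnu [_ Hu].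
  exists (fun s => / 2 * g s + / (2 * c) * RInt h 0 s),
    (fun s => - (/ 2 * g (- s) + / (2 * c) * RInt h 0 (- s)) + nu (- s / c)).
  intros x t Hxt; rewrite (Hu x t Hxt).
  destruct Hxt as [Ht [Hx Hct]]; simpl in Hx, Ht, Hct.
  split; [| split].
  - replace (- (x - c * t)) with (c * t - x) by ring.
    replace (t - x / c) with ((c * t - x) / c) by (field; lra).
    ring.
  - apply is_derive_forward; lra || assumption.
  - apply is_derive_backward_minus; lra || assumption.
Qed.

Theorem proposition2 (c : R) (g h nu : R -> R) (u : R -> R -> R) (dnu0 : R)
  (hc : 0 < c) (hg : C_half 2 g) (hh : C_half 1 h) (hnu : C_half 2 nu)
  (hdnu0 : is_derive_half nu 0 dnu0)
  (hu : dirichlet_solution c g h nu u) :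
  (forall x t, dom_plus c (x, t) \/ dom_minus c (x, t) -> has_partials u x t) /\
  (forall x, 0 < x ->
     is_jump c (partial_x u) x (/ c * h 0 - / c * dnu0) /\
     is_jump c (partial_t u) x (- h 0 + dnu0)) /\
  (/ c * h 0 - / c * dnu0 <> 0 -> ~ continuous_across c (partial_x u)) /\
  (- h 0 + dnu0 <> 0 -> ~ continuous_across c (partial_t u)).
Proof.
  assert (Hh := C_half_1_continuous h hh).
  destruct (C_half_2_C1 g hg) as [g' [Hg Cg]].
  destruct (C_half_2_C1 nu hnu) as [nu' [Hnu Cnu]].
  assert (Hd : nu' 0 = dnu0).
  { apply (is_derive_half_unique0 nu); [apply Hnu, Rle_refl | exact hdnu0]. }
  assert (Wp := dirichlet_wave_plus c g g' h nu u hc Hg Hh hu).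
  assert (Wm := dirichlet_wave_minus c g g' h nu nu' u hc Hg Hh Hnu hu).
  assert (HG : backward_minus' c g' h nu' 0 - backward_plus' c g' h 0
               = / c * h 0 - / c * dnu0).
  { unfold backward_minus', backward_plus'.
    replace (- 0 / c) with 0 by (field; lra).
    rewrite Ropp_0, !clamp_id, Hd by lra; field; lra. }
  assert (HJ : forall x, 0 < x ->
     is_jump c (partial_x u) x (/ c * h 0 - / c * dnu0) /\
     is_jump c (partial_t u) x (- h 0 + dnu0)).
  { intros x _.
    replace (- h 0 + dnu0) with (- c * (/ c * h 0 - / c * dnu0)) by (field; lra).
    rewrite <- HG.
    apply (wave_jumps c u (forward' c g' h)); try assumption; intros s.
    - now apply continuous_forward'.
    - now apply continuous_backward_minus'.
    - now apply continuous_backward_plus'. }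
  split; [| split; [exact HJ | split]].
  - intros x t [H | H].
    + destruct (is_derive_wave c _ u _ _ x t (open_dom_plus c) Wp H) as [Dx Dt].
      split; eexists; eassumption.
    + destruct (is_derive_wave c _ u _ _ x t (open_dom_minus c) Wm H) as [Dx Dt].
      split; eexists; eassumption.
  - apply nonzero_jump_discontinuous; [exact hc |].
    intros x Hx; apply (HJ x Hx).
  - apply nonzero_jump_discontinuous; [exact hc |].
    intros x Hx; apply (HJ x Hx).
Qed.
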